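(* Closure systems of poset type form a proper subclass of $D$-geometries. That is, every finite closure system of poset type is a $D$-geometry, and there exists a finite $D$-geometry $\langle G,\phi\rangle$ that is not of poset type (with respect to any partial order on $G$).
   Context: All sets are finite. A closure system $\langle G,\phi\rangle$ is a set $G$ with a closure operator $\phi:2^G\to 2^G$; $X$ is closed if $\phi(X)=X$. It is a convex geometry if $\phi(\emptyset)=\emptyset$ and the anti-exchange axiom holds: for all $x\neq y$ in $G$ and all closed $X\subseteq G$, if $x\in\phi(X\cup\{y\})$ and $x\notin X$, then $y\notin\phi(X\cup\{x\})$. A closure system is standard if $\phi(\{i\})\setminus\{i\}$ is closed for every $i\in G$; convex geometries are standard. An implication $X\to Y$ is an ordered pair of nonempty disjoint subsets of $G$; it holds in $\langle G,\phi\rangle$ if $Y\subseteq\phi(X)$; it is non-binary if $|X|\ge 2$. A set $\Sigma$ of implications defines the closure system whose closed sets are the $Z\subseteq G$ such that for all $(X\to Y)\in\Sigma$, $X\subseteq Z$ implies $Y\subseteq Z$. Poset type: given a poset $(P,\le)$, a closure system $\langle P,\phi\rangle$ is of poset type (with respect to $(P,\le)$) if it is defined by some set of implications $\{A_k\to B_k: k\le n\}$ such that for every $k$, all $a\in A_k$ and all $b\in B_k$, $b\le a$. These are also called $G$-geometries. $D$-geometry: a convex geometry without $D$-cycles, where for a standard closure system the $D$-basis $\Sigma_D$ consists of all implications $a\to b$ with $b\in\phi(\{a\})\setminus\{a\}$, together with all implications $A\to b$ with $|A|\ge 2$, $b\in\phi(A)\setminus A$, such that for every $a\in A$ and every $C\subseteq\phi(\{a\})\setminus\{a\}$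 the implication $(A\setminus\{a\})\cup C\to b$ does not hold, i.e. $b\notin\phi((A\setminus\{a\})\cup C)$. Write $bDa$ if $a\in A$ for some non-binary $(A\to b)\in\Sigma_D$. A $D$-cycle is a sequence $aDa_1D\cdots Da_kDa$; the system is without $D$-cycles if there is no such sequence. *)

(* Defs.v *)
From mathcomp Require Import all_boot.

Set Implicit Arguments.
Unset Strict Implicit.
Unset Printing Implicit Defensive.

Record closure_system (G : finType) := ClosureSystem {
  cl :> {set G} -> {set G};
  cl_extensive : forall X : {set G}, X \subset cl X;
  cl_monotone : forall X Y : {set G}, X \subset Y -> cl X \subset cl Y;
  cl_idempotent : forall X : {set G}, cl (cl X) = cl X }.

Definition is_closed (G : finType) (phi : closure_system G) (X : {set G}) : bool :=
  phi X == X.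

Definition convex_geometry (G : finType) (phi : closure_system G) : Prop :=
  phi set0 = set0 /\
  forall (x y : G) (X : {set G}), x != y -> is_closed phi X ->
    x \in phi (X :|: [set y]) -> x \notin X -> y \notin phi (X :|: [set x]).

(* The pair [(X, Y)] stands for X -> Y; well-formedness is [is_implication]. *)
Definition implication (G : finType) : Type := ({set G} * {set G})%type.

Definition is_implication (G : finType) (i : implication G) : bool :=
  [&& i.1 != set0, i.2 != set0 & [disjoint i.1 & i.2]].

Definition nonbinary (G : finType) (i : implication G) : bool := 2 <= #|i.1|.

Definition defines (G : finType) (Sigma : {set {set G} * {set G}})
    (phi : closure_system G) : Prop :=
  forall Z : {set G},
    is_closed phi Z <->
    (forall i : implication G, i \in Sigma -> i.1 \subset Z -> i.2 \subset Z).

Definition partial_order (P : finType) (le : rel P) : Prop :=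
  [/\ reflexive le, antisymmetric le & transitive le].

Definition poset_type (P : finType) (le : rel P) (phi : closure_system P) : Prop :=
  exists Sigma : {set {set P} * {set P}},
    [/\ forall i : implication P, i \in Sigma -> is_implication i,
        forall i : implication P, i \in Sigma ->
          forall a b : P, a \in i.1 -> b \in i.2 -> le b a
      & defines Sigma phi].

(* [D_basis_binary] and [D_basis_nonbinary] test whether A -> b is one of the
   two kinds of D-basis implications. The D-basis is normally considered for
   standard systems only; every convex geometry is standard. *)
Definition D_basis_binary (G : finType) (phi : closure_system G)
    (A : {set G}) (b : G) : bool :=
  [exists a : G, (A == [set a]) && (b \in phi [set a] :\ a)].

Definition D_basis_nonbinary (G : finType) (phi : closure_system G)
    (A : {set G}) (b : G) : bool :=
  [&& 2 <= #|A|, b \in phi A :\: A &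
    [forall a in A, forall C : {set G},
      (C \subset phi [set a] :\ a) ==> (b \notin phi ((A :\ a) :|: C))]].

Definition D_basis (G : finType) (phi : closure_system G) :
    {set {set G} * {set G}} :=
  [set i : {set G} * {set G} |
    [exists b : G, (i.2 == [set b]) &&
      (D_basis_binary phi i.1 b || D_basis_nonbinary phi i.1 b)]].

Definition D_rel (G : finType) (phi : closure_system G) : rel G :=
  fun b a => [exists A : {set G},
    [&& (A, [set b]) \in D_basis phi, nonbinary (A, [set b]) & a \in A]].

(* [cycle (D_rel phi) (a :: s)] says a D a_1 D ... D a_k D a for
   s = [:: a_1; ...; a_k]. The case s = [::] is harmless: [D_rel phi] is
   irreflexive because A -> b in the D-basis forces b \notin A. *)
Definition without_D_cycles (G : finType) (phi : closure_system G) : Prop :=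
  forall (a : G) (s : seq G), ~~ cycle (D_rel phi) (a :: s).

Definition D_geometry (G : finType) (phi : closure_system G) : Prop :=
  convex_geometry phi /\ without_D_cycles phi.

(* Main.v *)
Require Import Defs.
From mathcomp Require Import all_boot.

(** In a system of poset type every derivation of [b] descends to [b], so only
    the premises above [b] matter ([poset_type_below]). Hence an element [y] that
    cannot be dropped from a set generating [x] satisfies [x <= y]. Two elements
    violating anti-exchange would be below each other, and [b D a] forces
    [b < a], so there is no D-cycle.

    The inclusion is strict because a poset type must orient both the D-relation
    and the binary implications the same way, whereas a D-geometry only
    needs the D-relation itself to be acyclic. The example has six elements
    [a_i, b_i, c_i] with [i] in Z/2, and the implications
<<
      b_i -> a_(i+1),    c_i -> a_(i+1),    {a_i, c_i} -> b_i.
>>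
    The D-relation goes from [b_i] to [a_i] and [c_i] only. Any order making the
    system of poset type would give [b_0 <= a_0 <= b_1 <= a_1 <= b_0], the steps
    coming alternately from the D-relation and from [b_i -> a_(i+1)].
    The implication [c_i -> a_(i+1)] is what keeps the D-relation acyclic:
    without it, [{a_i, c_i} -> a_(i+1)] would be in the D-basis, so [a_0] and
    [a_1] would form a D-cycle. *)

Lemma D_relP {G : finType} (phi : closure_system G) (b a : G) :
  D_rel phi b a -> exists2 A : {set G}, a \in A & D_basis_nonbinary phi A b.
Proof.
case/existsP=> A /and3P[+ A2 aA]; rewrite inE => /existsP[b' /andP[/= /eqP/set1_inj <-]].
case/orP=> [/existsP[x /andP[/eqP Ax _]] | HA]; last by exists A.
by move: A2; rewrite /nonbinary /= Ax cards1.
Qed.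

Lemma D_rel_basis_drop {G : finType} (phi : closure_system G) (A C : {set G}) (a b : G) :
    D_basis_nonbinary phi A b -> a \in A -> C \subset phi [set a] :\ a ->
  b \notin phi ((A :\ a) :|: C).
Proof. by case/and3P=> _ _ /forall_inP H /H/forallP/(_ C)/implyP; apply. Qed.

Lemma without_D_cycles_sub_strict {G : finType} (phi : closure_system G) (lt : rel G) :
    irreflexive lt -> transitive lt -> subrel (D_rel phi) lt ->
  without_D_cycles phi.
Proof.
move=> ltxx lt_trans sub a s; apply/negP => /(sub_path sub)/(order_path_min lt_trans).
by move/allP/(_ a); rewrite mem_rcons mem_head ltxx => /(_ isT).
Qed.

Section PosetType.

Variables (P : finType) (le : rel P) (phi : closure_system P).
Hypotheses (le_po : partial_order le) (phi_poset : poset_type le phi).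

(** Adding to [phi (X :&: up b)] all elements that are not above [b] gives a closed
    set: an implication with a premise not above [b] has no conclusion above [b],
    and the others have all their premises in the closed part. *)
Lemma poset_type_below (X : {set P}) (b : P) :
  b \in phi X -> b \in phi (X :&: [set x | le b x]).
Proof.
case: le_po phi_poset => lexx _ le_trans [Sigma [_ Sle Sdef]].
set Y := X :&: _; pose Z := phi Y :|: [set x | ~~ le b x].
have clY : is_closed phi (phi Y) by rewrite /is_closed cl_idempotent.
have/eqP clZ : is_closed phi Z.
  apply/Sdef => i iS iZ; apply/subsetP => c ci; rewrite !inE.
  case: (boolP (le b c)) => lebc; last by rewrite orbT.
  rewrite orbF; suff /(proj1 (Sdef _) clY i iS)/subsetP : i.1 \subset phi Y by apply.
  apply/subsetP => a ai; move/subsetP/(_ a ai): iZ; rewrite !inE.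
  by rewrite (le_trans _ _ _ lebc (Sle _ iS _ _ ai ci)) orbF.
have XZ : X \subset Z.
  apply/subsetP => x xX; rewrite !inE; case: (boolP (le b x)) => lebx; last by rewrite orbT.
  by rewrite (subsetP (cl_extensive phi Y)) // !inE xX.
by move/(subsetP (cl_monotone phi XZ)); rewrite clZ !inE lexx orbF.
Qed.

Lemma poset_type_essential (X : {set P}) (x y : P) :
  x \in phi (X :|: [set y]) -> x \notin phi X -> le x y.
Proof.
move=> /poset_type_below xXy; apply: contraNT => lexy.
apply: (subsetP (cl_monotone phi _)) xXy; apply/subsetP => z; rewrite !inE.
by case/andP=> /orP[// | /eqP-> /(negP lexy)].
Qed.

Lemma poset_type_cl0 : phi set0 = set0.
Proof.
case: phi_poset => Sigma [Simp _ Sdef]; apply/eqP/Sdef => i iS.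
by rewrite subset0 => i0; case/and3P: (Simp _ iS); rewrite i0.
Qed.

Lemma poset_type_convex : convex_geometry phi.
Proof.
split=> [|x y X neq_xy /eqP clX xXy xX]; first exact: poset_type_cl0.
apply/negP => yXx; case: le_po => _ le_anti _; case/eqP: neq_xy; apply: le_anti.
rewrite (@poset_type_essential X) ?clX // (@poset_type_essential X) ?clX //.
apply: contra xX => yX; move: xXy; rewrite -[in X in _ -> X]clX.
by apply: (subsetP (cl_monotone phi _)); rewrite subUset subxx sub1set.
Qed.

Lemma poset_type_D_rel (b a : P) : D_rel phi b a -> (b != a) && le b a.
Proof.
case/D_relP=> A aA HA; case/and3P: (HA) => _ /setDP[bA bnA] _.
rewrite (contraNneq _ bnA) => [|->] //=.
apply: (@poset_type_essential (A :\ a)); first by rewrite setUC setD1K.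
by rewrite -[A :\ a]setU0; apply: D_rel_basis_drop; rewrite ?sub0set.
Qed.

Lemma poset_type_D_geometry : D_geometry phi.
Proof.
split; first exact: poset_type_convex.
case: le_po => lexx le_anti le_trans.
apply: (without_D_cycles_sub_strict _ (fun b a => (b != a) && le b a)) => [x|y x z|].
- by rewrite eqxx.
- move=> /andP[xy lexy] /andP[_ leyz]; rewrite (le_trans _ _ _ lexy leyz) andbT.
  by apply: contraNneq xy => xz; apply/eqP/le_anti; rewrite lexy xz.
- exact: poset_type_D_rel.
Qed.

End PosetType.

(** The summands hold, from left to right, the elements [a_i], [b_i] and [c_i]. *)
Definition hexad : finType := (bool + bool + bool)%type.

Notation ea i := (inl (inl i) : hexad).
Notation eb i := (inl (inr i) : hexad).
Notation ec i := (inr i : hexad).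

Definition hexad_cl (X : {set hexad}) : {set hexad} :=
  let has_a i := [|| ea i \in X, eb (~~ i) \in X | ec (~~ i) \in X] in
  [set x : hexad | match x with
    | inl (inl i) => has_a i
    | inl (inr i) => (eb i \in X) || (ec i \in X) && has_a i
    | inr i => ec i \in X
    end].

Ltac case_mems := repeat match goal with |- context [in_mem ?z ?A] => case: (in_mem z A) end.

Lemma hexad_cl_extensive (X : {set hexad}) : X \subset hexad_cl X.
Proof. by apply/subsetP => -[[]|] i xX; rewrite !inE xX. Qed.

Lemma hexad_cl_monotone (X Y : {set hexad}) :
  X \subset Y -> hexad_cl X \subset hexad_cl Y.
Proof.
move=> /subsetP XY; apply/subsetP => -[[]|] i; rewrite !inE.
- by case/or3P => /XY->; rewrite ?orbT.
- by case/orP => [/XY-> // | /andP[/XY-> /or3P[] /XY->]]; rewrite ?orbT.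
- exact: XY.
Qed.

(** One pass computes the closure: the clause for [b_i] already allows [a_i] to be
    derived, and deriving [b_i] takes [c_i], which alone yields the only
    consequence [a_(i+1)] of [b_i]. *)
Lemma hexad_cl_idempotent (X : {set hexad}) : hexad_cl (hexad_cl X) = hexad_cl X.
Proof.
apply/setP => -[[]|] i; rewrite !inE ?negbK //; by case_mems.
Qed.

Definition hexad_closure : closure_system hexad :=
  ClosureSystem hexad_cl_extensive hexad_cl_monotone hexad_cl_idempotent.

(** An exchange over a closed [X] cannot involve a [c_i], which is never derived.
    It could be between [a_i] and [b_(i+1)], or between [b_0] and [b_1]. Deriving
    [b_j] requires [c_j] in [X], which puts [a_(j+1)] in [X]. In the first case [a_i]
    is thus already in [X]; in the second [X] contains [a_0], [a_1], [c_0] and [c_1],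
    hence everything. *)
Lemma hexad_convex : convex_geometry hexad_closure.
Proof.
split=> [|x y X + /eqP clX]; first by apply/setP => -[[]|] i; rewrite !inE.
have clX' z : (z \in hexad_cl X) = (z \in X) by rewrite -[in RHS]clX.
have Ha i := clX' (ea i); have Hb i := clX' (eb i).
move: (Ha true) (Ha false) (Hb true) (Hb false); rewrite !inE /=.
move: x y => [[]|] [] [[]|] [] //=; rewrite !inE /=; by case_mems.
Qed.

Definition is_b (x : hexad) : bool := if x is inl (inr _) then true else false.

(** Deriving [a_i] takes a single premise and [c_i] is never derived, so only
    the [b_i] have a nonbinary implication in the D-basis. In one for [b_i] the
    premise [b_(i+1)] could be replaced by [a_i], which lies in its closure. *)
Lemma hexad_D_rel (x y : hexad) :
  D_rel hexad_closure x y -> is_b x && ~~ is_b y.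
Proof.
case/D_relP=> A yA HA; have drop C a := @D_rel_basis_drop _ _ _ C a _ HA.
case/and3P: HA => A2 /setDP[xA xnA] _.
move: x xA xnA drop => [[]|] i; rewrite !inE; last by move->.
- move=> H /negPf aA drop; rewrite aA /= in H.
  have{H} [d dA dcl] : exists2 d, d \in A &
      forall X : {set hexad}, d \in X -> ea i \in hexad_cl X.
    case/orP: H => H; [exists (eb (~~ i)) | exists (ec (~~ i))] => // X dX.
      by rewrite !inE dX orbT.
    by rewrite !inE dX !orbT.
  (* [d] alone yields [a_i], so any other premise [e] can be dropped. *)
  have /card_gt0P[e] : 0 < #|A :\ d| by move: A2; rewrite (cardsD1 d) dA.
  rewrite !inE => /andP[ed eA].
  have /negP[] := drop set0 e eA (sub0set _).
  by apply: dcl; rewrite !inE eq_sym ed dA.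
- move=> H bnA drop; rewrite (negPf bnA) /= in H; case/andP: H => cA _.
  case: y yA => [[]|] j // bA.
  have ji : j = ~~ i by move: i j bA bnA {cA drop} => [] [] // ->.
  have aPb : [set ea i] \subset hexad_cl [set eb j] :\ eb j.
    by rewrite sub1set !inE ji eqxx /= ?orbT.
  have /negP[] := drop [set ea i] _ bA aPb.
  by rewrite !inE cA eqxx /= ?orbT.
Qed.

Lemma hexad_D_geometry : D_geometry hexad_closure.
Proof.
split; first exact: hexad_convex.
apply: without_D_cycles_sub_strict hexad_D_rel => [x | y x z /andP[_ /negPf nby] /andP[]].
  exact: andbN.
by rewrite nby.
Qed.

Lemma hexad_not_poset_type (le : rel hexad) :
  partial_order le -> ~ poset_type le hexad_closure.
Proof.
move=> le_po pt; have [_ le_anti le_trans] := le_po.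
have ess := poset_type_essential _ _ _ le_po pt.
have leba i : le (eb i) (ea i).
  by apply: (ess [set ec i]); rewrite !inE ?eqxx //=; case: i.
have leab i : le (ea i) (eb (~~ i)).
  by apply: (ess set0); rewrite !inE ?eqxx ?orbT.
have leab' : le (ea true) (eb true).
  exact: le_trans (le_trans _ _ _ (leab true) (leba false)) (leab false).
by have /le_anti : le (ea true) (eb true) && le (eb true) (ea true) by rewrite leab' leba.
Qed.

Theorem corollary22 :
  (forall (P : finType) (le : rel P) (phi : closure_system P),
     partial_order le -> poset_type le phi -> D_geometry phi) /\
  (exists (G : finType) (phi : closure_system G),
     D_geometry phi /\
     (forall le : rel G, partial_order le -> ~ poset_type le phi)).
Proof.
split; first exact: poset_type_D_geometry.
exists hexad, hexad_closure; split; first exact: hexad_D_geometry.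
exact: hexad_not_poset_type.
Qed.
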